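(* For every $n\ge 1$, $ASM^{\circ}_{n,4}$ is in bijection with the set of $2n\times 2n$ alternating sign matrices.
   Context: An alternating sign matrix is a square matrix with entries in $\{0,1,-1\}$ such that each row and each column sums to $1$ and the nonzero entries alternate in sign along each row and each column. For $n,k\ge1$, $ASM^{\circ}_{n,k}$ (chained circular alternating sign matrices) is the set of $k$-tuples $(A^{(1)},\dots,A^{(k)})$ of $n\times n$ matrices with entries in $\{-1,0,1\}$ satisfying: (1) $\sum_{j=1}^m A^{(\ell)}_{i,j}\in\{0,1\}$ for all $1\le i\le n$, $1\le m\le n$, $1\le\ell\le k$; (2) $\sum_{j=1}^n A^{(\ell-1)}_{i,j}+\sum_{j=1}^m A^{(\ell)}_{n+1-j,i}\in\{0,1\}$ for all $1\le i\le n$, $1\le m\le n$, $1\le\ell\le k$, where $A^{(0)}=A^{(k)}$; (3) the sum of all entries $\sum_{i,j,\ell}A^{(\ell)}_{i,j}$ is maximum among all such $k$-tuples satisfying (1) and (2). *)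

(* Defs.v *)
From HB Require Import structures.
From mathcomp Require Import all_boot all_order all_algebra.
From mathcomp Require Import classical_sets functions.

Set Implicit Arguments.
Unset Strict Implicit.
Unset Printing Implicit Defensive.

Import GRing.Theory.
Local Open Scope ring_scope.

Definition sign_entries (n : nat) (A : 'M[int]_n) : Prop :=
  forall i j : 'I_n, A i j \in [:: -1; 0; 1].

(* Consecutive nonzero entries of a line have opposite signs. *)
Definition alternating (n : nat) (v : 'I_n -> int) : Prop :=
  forall j1 j2 : 'I_n, (j1 < j2)%N ->
    v j1 != 0 -> v j2 != 0 ->
    (forall j : 'I_n, (j1 < j < j2)%N -> v j = 0) ->
    Num.sg (v j2) = - Num.sg (v j1).

Definition ASM (n : nat) : set 'M[int]_n :=
  [set A : 'M[int]_n |
    [/\ sign_entries A,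
        (forall i : 'I_n, \sum_(j < n) A i j = 1),
        (forall j : 'I_n, \sum_(i < n) A i j = 1),
        (forall i : 'I_n, alternating (fun j => A i j))
      & (forall j : 'I_n, alternating (fun i => A i j))]].

(* All indices start at 0, so the partial sum over 1 <= j <= m becomes a sum
   over j <= m with m : 'I_n, and n + 1 - j becomes rev_ord j.  The layer
   preceding A^(l) is indexed by ord_pred l, which wraps around, in accordance
   with A^(0) = A^(k). *)
Definition chained_circular (n k : nat) (A : k.-tuple 'M[int]_n) : Prop :=
  [/\ (forall l : 'I_k, sign_entries (tnth A l)),
      (forall (l : 'I_k) (i m : 'I_n),
         \sum_(j < n | (j <= m)%N) tnth A l i j \in [:: 0; 1])
    & (forall (l : 'I_k) (i m : 'I_n),
         \sum_(j < n) tnth A (ord_pred l) i j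
           + \sum_(j < n | (j <= m)%N) tnth A l (rev_ord j) i \in [:: 0; 1])].

Definition total_sum (n k : nat) (A : k.-tuple 'M[int]_n) : int :=
  \sum_(l < k) \sum_(i < n) \sum_(j < n) tnth A l i j.

Definition ASMcirc (n k : nat) : set (k.-tuple 'M[int]_n) :=
  [set A : k.-tuple 'M[int]_n |
    chained_circular A /\
    (forall B : k.-tuple 'M[int]_n,
       chained_circular B -> total_sum B <= total_sum A)].

Arguments ASM n : clear implicits.
Arguments ASMcirc n k : clear implicits.

(* Main.v *)
Require Import Defs.
From HB Require Import structures.
From mathcomp Require Import all_boot all_order all_algebra.
From mathcomp Require Import classical_sets functions.
From mathcomp Require Import zify.

(** A chained circular tuple of four matrices is a single square matrix of size
    2n seen from its four corners.  Cut a matrix M of size 2n into quadrants and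
    let A^(l) be the upper left quadrant of M turned l times by a quarter turn
    ([corners]).  Reading row i of A^(l-1) from left to right, then column i of
    A^(l) from bottom to top, amounts to reading the whole row i of M turned
    l - 1 times.  Hence conditions (1) and (2) say that these 4n lines, which
    are the 2n rows and the 2n columns of M, each read in one of its two
    directions, have all their partial sums in {0, 1}
    ([chained_cornersP]).

    Every entry of the tuple lies on exactly two of the lines, so that twice the
    total sum is the sum of 4n line sums ([total_corners]), each at most 1.  The
    bound 2n is reached, for instance by the identity matrix, and so a tuple has
    maximum total sum exactly when each line sums to 1.

    Finally, a line with sum 1 has its partial sums in {0, 1} if and only if its
    entries lie in {-1, 0, 1} and its nonzero entries alternate in sign
    ([unit_lineP]).  This property does not depend on the direction of reading,
    so the lines seen from the four corners satisfy it exactly when M is an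
    alternating sign matrix ([ASM_cornersP]). *)

Set Implicit Arguments.
Unset Strict Implicit.
Unset Printing Implicit Defensive.

Import Order.TTheory GRing.Theory Num.Theory.
Local Open Scope ring_scope.

(** * Partial sums along a line *)

Definition psum N (v : 'I_N -> int) (k : nat) : int :=
  \sum_(j < N | (j < k)%N) v j.

Definition unit_psums N (v : 'I_N -> int) : Prop :=
  forall k : nat, psum v k \in [:: 0; 1].

Definition unit_line N (v : 'I_N -> int) : Prop :=
  unit_psums v /\ \sum_j v j = 1.

Lemma bitE (x : int) : x \in [:: 0; 1] -> x = 0 \/ x = 1.
Proof. by rewrite !inE => /orP[/eqP->|/eqP->]; [left | right]. Qed.

Lemma trit_or (x : int) : x \in [:: -1; 0; 1] -> [\/ x = -1, x = 0 | x = 1].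
Proof.
by rewrite !inE => /or3P[/eqP->|/eqP->|/eqP->];
  [constructor 1 | constructor 2 | constructor 3].
Qed.

Lemma eq_psum N (v w : 'I_N -> int) k : v =1 w -> psum v k = psum w k.
Proof. by move=> vw; apply: eq_bigr => j _; apply: vw. Qed.

Lemma eq_unit_psums N (v w : 'I_N -> int) :
  v =1 w -> unit_psums v -> unit_psums w.
Proof. by move=> vw vP k; rewrite -(eq_psum k vw). Qed.

Lemma eq_unit_line N (v w : 'I_N -> int) : v =1 w -> unit_line v -> unit_line w.
Proof.
move=> vw [vP vS]; split; first exact: eq_unit_psums vw vP.
by rewrite -vS; apply: eq_bigr => j _; rewrite vw.
Qed.

Lemma psum0 N (v : 'I_N -> int) : psum v 0 = 0.
Proof. exact: big_pred0. Qed.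

Lemma psumS N (v : 'I_N -> int) (j : 'I_N) : psum v j.+1 = psum v j + v j.
Proof.
rewrite /psum (bigD1 j) //= addrC; congr (_ + _).
by apply: eq_bigl => i; rewrite -val_eqE /=; lia.
Qed.

Lemma psum_all N (v : 'I_N -> int) k : (N <= k)%N -> psum v k = \sum_j v j.
Proof.
by move=> Nk; apply: eq_bigl => j; rewrite (leq_trans (ltn_ord j) Nk).
Qed.

Lemma psum_rev N (v : 'I_N -> int) k :
  psum (v \o @rev_ord N) k = \sum_j v j - psum v (N - k).
Proof.
rewrite (bigID (fun j : 'I_N => (j < N - k)%N)) /= addrC addrK.
rewrite /psum (reindex_inj rev_ord_inj) /=.
apply: eq_big => j; last by rewrite rev_ordK.
by have := ltn_ord j; lia.
Qed.

Lemma psum_split n (v : 'I_(n + n) -> int) k :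
  psum v k = psum (v \o lshift n) k + psum (v \o @rshift n n) (k - n).
Proof.
rewrite /psum big_split_ord /=; congr (_ + _).
by apply: eq_bigl => j /=; lia.
Qed.

Lemma unit_psumsP N (v : 'I_N -> int) :
  unit_psums v <->
  forall m : 'I_N, \sum_(j < N | (j <= m)%N) v j \in [:: 0; 1].
Proof.
split=> [vP m | vP]; first exact: (vP m.+1).
have short k : (k <= N)%N -> psum v k \in [:: 0; 1].
  by case: k => [|k] kN; [rewrite psum0 | apply: (vP (Ordinal kN))].
move=> k; have [/short// | /ltnW Nk] := leqP k N.
by rewrite psum_all // -(psum_all v (leqnn N)); apply: short.
Qed.

(** A line of length 2n is read as two consecutive segments of length n: this is
    the common shape of conditions (1) and (2). *)
Lemma unit_psums_split n (v : 'I_(n + n) -> int) :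
  unit_psums v <->
  (forall m : 'I_n, \sum_(j < n | (j <= m)%N) v (lshift n j) \in [:: 0; 1]) /\
  (forall m : 'I_n, \sum_j v (lshift n j)
     + \sum_(j < n | (j <= m)%N) v (rshift n j) \in [:: 0; 1]).
Proof.
split=> [vP | [lP rP]].
  split=> m.
    have := vP m.+1; rewrite psum_split.
    have -> : (m.+1 - n = 0)%N by have := ltn_ord m; lia.
    by rewrite psum0 addr0.
  have := vP (n + m.+1)%N; rewrite psum_split addKn psum_all //.
  exact: leq_addr.
apply/unit_psumsP => m; rewrite -[X in X \in _]/(psum v m.+1) psum_split.
have [mn | nm] := ltnP m n.
  have -> : (m.+1 - n = 0)%N by lia.
  by rewrite psum0 addr0; apply: (lP (Ordinal mn)).
have m'n : (m - n < n)%N by have := ltn_ord m; lia.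
rewrite psum_all ?subSn //; last exact: leqW.
exact: (rP (Ordinal m'n)).
Qed.

Lemma unit_psums_entry N (v : 'I_N -> int) (j : 'I_N) :
  unit_psums v -> v j \in [:: -1; 0; 1].
Proof.
move=> vP; have := psumS v j; rewrite !inE.
by have [->|->] := bitE (vP j); have [->|->] := bitE (vP j.+1); lia.
Qed.

Lemma unit_line_rev N (v : 'I_N -> int) :
  unit_line v -> unit_line (v \o @rev_ord N).
Proof.
move=> [vP vS]; split.
  by move=> k; rewrite psum_rev vS; have [->|->] := bitE (vP (N - k)%N).
by rewrite -vS [RHS](reindex_inj rev_ord_inj).
Qed.

(** * Alternation of signs *)

Lemma psum_const N (v : 'I_N -> int) a b :
  (a <= b <= N)%N -> (forall j : 'I_N, (a <= j < b)%N -> v j = 0) ->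
  psum v b = psum v a.
Proof.
elim: b => [|b IHb] abN v0; first by have -> : a = 0%N by lia.
have [ab | ba] := leqP a b; last by have -> : a = b.+1 by lia.
have bN : (b < N)%N by lia.
rewrite (psumS v (Ordinal bN)) v0 /=; last by lia.
by rewrite addr0; apply: IHb => [|j jb]; [lia | apply: v0; lia].
Qed.

(** An entry 1 lifts the partial sum to 1, from where only an entry - 1 can
    move it; and conversely at 0. *)
Lemma unit_psums_alternating N (v : 'I_N -> int) :
  unit_psums v -> alternating v.
Proof.
move=> vP i j ij vi vj v0.
(* The partial sum is the same just after position i and just before j. *)
have eqP : psum v j = psum v i.+1.
  by apply: psum_const => [|h]; [have := ltn_ord j; lia | apply: v0].
have vE (h : 'I_N) : v h = psum v h.+1 - psum v h.
  by rewrite psumS addrAC subrr add0r.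
move: vi vj; rewrite !vE eqP.
by have [->|->] := bitE (vP i); have [->|->] := bitE (vP i.+1);
  have [->|->] := bitE (vP j.+1).
Qed.

(** Let s be the first nonzero entry.  Alternation keeps the partial sum equal
    to s after an entry s, and to 0 after an entry - s. *)
Lemma alternating_psum N (v : 'I_N -> int) (i0 : 'I_N) :
  (forall j, v j \in [:: -1; 0; 1]) -> alternating v ->
  v i0 != 0 -> (forall j : 'I_N, (j < i0)%N -> v j = 0) ->
  forall k, (k <= N)%N -> psum v k = 0 \/ psum v k = v i0.
Proof.
move=> vE valt v0 before; set s := v i0.
have start k : (k <= i0)%N -> psum v k = 0.
  move=> ki0; rewrite (psum_const (a := 0)) ?psum0 // => [|j jk].
    by have := ltn_ord i0; lia.
  by apply: before; lia.
(* The witness i is the last nonzero entry before position k. *)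
suff inv k : (i0 < k)%N -> (k <= N)%N ->
    exists i : 'I_N, [/\ (i < k)%N, v i != 0,
      forall j : 'I_N, (i < j < k)%N -> v j = 0 &
      (v i = s /\ psum v k = s) \/ (v i = - s /\ psum v k = 0)].
  move=> k kN; have [/start|i0k] := leqP k i0; first by left.
  by have [i [_ _ _ [[_ ->]|[_ ->]]]] := inv k i0k kN; [right | left].
elim: k => [//|k IHk] i0k kN.
have [ki0 | neq] := eqVneq k i0.
  exists i0; split=> //; first by move=> j; lia.
  by left; rewrite ki0 psumS start // add0r.
have [||i [ik vi gap inv]] := IHk; [lia | lia |].
rewrite (psumS v (Ordinal kN)); set j := Ordinal kN.
have [vj | vj] := eqVneq (v j) 0.
  exists i; split=> //; [lia | | by rewrite vj addr0].
  move=> h hk; have [hk' | hk'] := eqVneq (h : nat) k; last by apply: gap; lia.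
  by rewrite -vj; congr v; apply: val_inj.
exists j; split=> //; first by move=> h /=; lia.
have : v j = - v i.
  have := valt i j ik vi vj gap.
  move: vi vj; have [->|->|->] := trit_or (vE i);
    by have [->|->|->] := trit_or (vE j).
by case: inv => -[-> ->] ->; [right | left]; split; rewrite ?opprK ?subrr ?add0r.
Qed.

Lemma unit_lineP N (v : 'I_N -> int) :
  unit_line v <->
  [/\ forall j, v j \in [:: -1; 0; 1], \sum_j v j = 1 & alternating v].
Proof.
split=> [[vP vS] | [vE vS valt]].
  split=> //; last exact: unit_psums_alternating.
  by move=> j; apply: unit_psums_entry.
split=> //.
have [i vi first_i] : exists2 i : 'I_N, v i != 0 &
    forall j : 'I_N, (j < i)%N -> v j = 0.
  have [i0 vi0] : exists i, v i != 0.
    apply/existsP; apply: contraT => /existsPn v0; move: vS.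
    by rewrite big1 // => j _; apply/eqP; have := v0 j; rewrite negbK.
  have [i vi min_i] := @arg_minnP _ i0 (fun i => v i != 0) (@nat_of_ord N) vi0.
  exists i => // j ji; apply/eqP; apply: contraLR ji => /min_i.
  by rewrite -leqNgt.
have vals := alternating_psum vE valt vi first_i.
have vi1 : v i = 1.
  by have := vals N (leqnn N); rewrite psum_all // vS => -[].
apply/unit_psumsP => m; rewrite -[X in X \in _]/(psum v m.+1).
by have := vals m.+1 (ltn_ord m); rewrite vi1 => -[->|->].
Qed.

(** * Quarter turns and corners *)

(** Turning counterclockwise brings the upper right corner to the upper left. *)
Definition turn n (M : 'M[int]_n) : 'M[int]_n := \matrix_(i, j) M j (rev_ord i).

Definition corners n (M : 'M[int]_(n + n)) : 4.-tuple 'M[int]_n :=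
  [tuple ulsubmx (iter l (@turn _) M) | l < 4].

(** Three more quarter turns undo one, two more undo two, one more undoes three:
    each A^(l) is turned back into the quadrant from which it was cut. *)
Definition glue n (A : 4.-tuple 'M[int]_n) : 'M[int]_(n + n) :=
  block_mx (tnth A (inord 0)) (iter 3 (@turn n) (tnth A (inord 1)))
           (turn (tnth A (inord 3))) (iter 2 (@turn n) (tnth A (inord 2))).

Lemma turn4 n (M : 'M[int]_n) : iter 4 (@turn n) M = M.
Proof. by apply/matrixP => i j; rewrite !mxE !rev_ordK. Qed.

Lemma rev_lshift n (i : 'I_n) : rev_ord (lshift n i) = rshift n (rev_ord i).
Proof. by apply: val_inj => /=; have := ltn_ord i; lia. Qed.

Lemma rev_rshift n (i : 'I_n) : rev_ord (rshift n i) = lshift n (rev_ord i).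
Proof. by apply: val_inj => /=; have := ltn_ord i; lia. Qed.

Lemma turn_block n (a b c d : 'M[int]_n) :
  turn (block_mx a b c d) = block_mx (turn b) (turn d) (turn a) (turn c).
Proof.
apply/matrixP => i j; rewrite mxE.
by case: (split_ordP i) => i' ->; case: (split_ordP j) => j' ->;
  rewrite ?rev_lshift ?rev_rshift ?block_mxEul ?block_mxEur ?block_mxEdl
    ?block_mxEdr mxE.
Qed.

Lemma ord4E (l : 'I_4) : [\/ l = inord 0, l = inord 1, l = inord 2 | l = inord 3].
Proof.
case: l => [[|[|[|[|//]]]] lt4];
  [constructor 1 | constructor 2 | constructor 3 | constructor 4];
  by apply: val_inj; rewrite /= inordK.
Qed.

Lemma glueK n : cancel (@glue n) (@corners n).
Proof.
move=> A; apply: eq_from_tnth => l; rewrite tnth_mktuple /glue.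
have [->|->|->|->] := ord4E l; rewrite inordK //= ?turn_block block_mxKul //;
  by rewrite -[RHS]turn4.
Qed.

Lemma cornersK n : cancel (@corners n) (@glue n).
Proof.
move=> M; rewrite -[M]submxK /glue !tnth_mktuple !inordK //=.
by rewrite !turn_block !block_mxKul; congr block_mx; rewrite -[RHS]turn4.
Qed.

Lemma iter_turn_pred n (M : 'M[int]_n) (l : 'I_4) :
  iter l (@turn n) M = turn (iter (ord_pred l) (@turn n) M).
Proof.
by case: l => [[|[|[|[|//]]]] lt4] //=; rewrite -[LHS]turn4.
Qed.

(** The lines along which conditions (1) and (2) constrain [corners M]. *)
Definition line n (M : 'M[int]_(n + n)) (l : 'I_4) (i : 'I_n) :
    'I_(n + n) -> int :=
  iter l (@turn _) M (lshift n i).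

Lemma cornersE n (M : 'M[int]_(n + n)) l i j :
  tnth (corners M) l i j = line M l i (lshift n j).
Proof. by rewrite tnth_mktuple !mxE. Qed.

(** The second half of a line is a column of the next corner, read upwards. *)
Lemma corners_line n (M : 'M[int]_(n + n)) l i j :
  tnth (corners M) l (rev_ord j) i = line M (ord_pred l) i (rshift n j).
Proof.
by rewrite cornersE /line iter_turn_pred mxE rev_lshift rev_ordK.
Qed.

Lemma chained_cornersP n (M : 'M[int]_(n + n)) :
  chained_circular (corners M) <-> forall l i, unit_psums (line M l i).
Proof.
split=> [[_ rowP turnP] l i | MP].
  apply/unit_psums_split; split=> m.
    have := rowP l i m.
    by under eq_bigr do rewrite cornersE.
  have := turnP (ordS l) i m; rewrite ordSK.
  under eq_bigr do rewrite cornersE.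
  by under [X in _ + X]eq_bigr do rewrite corners_line ordSK.
split=> [l i j | l i m | l i m].
- by rewrite cornersE; apply: unit_psums_entry.
- under eq_bigr do rewrite cornersE.
  by have [] := (unit_psums_split _).1 (MP l i).
- under eq_bigr do rewrite cornersE.
  under [X in _ + X]eq_bigr do rewrite corners_line.
  by have [_] := (unit_psums_split _).1 (MP (ord_pred l) i).
Qed.

(** Every entry lies on one line as part of a row and on one as part of a
    column. *)
Lemma total_corners n (M : 'M[int]_(n + n)) :
  \sum_l \sum_i \sum_j line M l i j = total_sum (corners M) *+ 2.
Proof.
rewrite mulr2n /total_sum.
transitivity (\sum_l \sum_i (\sum_j line M l i (lshift n j)
                             + \sum_j line M l i (rshift n j))).
  by do 2!apply: eq_bigr => ? _; rewrite big_split_ord.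
under eq_bigr do rewrite big_split /=.
rewrite big_split /=; congr (_ + _).
  by do 3!apply: eq_bigr => ? _; rewrite cornersE.
rewrite (reindex_inj (can_inj (@ord_predK 4))) /=.
apply: eq_bigr => l _; rewrite exchange_big (reindex_inj rev_ord_inj) /=.
by do 2!apply: eq_bigr => ? _; rewrite -corners_line rev_ordK.
Qed.

(** * Alternating sign matrices seen from their corners *)

Lemma ASM_linesP N (M : 'M[int]_N) :
  ASM N M <->
  (forall i, unit_line (fun j => M i j)) /\ (forall j, unit_line (fun i => M i j)).
Proof.
split=> [[ME rowS colS rowA colA] | [rowP colP]].
  by split=> i; apply/unit_lineP; split.
split=> i; first by move=> j; have [+ _ _] := (unit_lineP _).1 (rowP i); apply.
- by have [] := (unit_lineP _).1 (rowP i).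
- by have [] := (unit_lineP _).1 (colP i).
- by have [] := (unit_lineP _).1 (rowP i).
- by have [] := (unit_lineP _).1 (colP i).
Qed.

Lemma ASM_turn N (M : 'M[int]_N) : ASM N M -> ASM N (turn M).
Proof.
move=> /ASM_linesP[rowP colP]; apply/ASM_linesP; split=> i.
  by apply: eq_unit_line (colP (rev_ord i)) => j; rewrite mxE.
by apply: eq_unit_line (unit_line_rev (rowP i)) => j; rewrite mxE.
Qed.

(** Two opposite corners see all the rows, the lower ones backwards. *)
Lemma rows_from_corners n (M : 'M[int]_(n + n)) :
  (forall i, unit_line (M (lshift n i))) ->
  (forall i, unit_line (turn (turn M) (lshift n i))) ->
  forall i, unit_line (M i).
Proof.
move=> upP downP i; case: (split_ordP i) => i' ->; first exact: upP.
apply: eq_unit_line (unit_line_rev (downP (rev_ord i'))) => j /=.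
by rewrite !mxE rev_ordK rev_lshift rev_ordK.
Qed.

Lemma ASM_cornersP n (M : 'M[int]_(n + n)) :
  ASM (n + n) M <-> forall l i, unit_line (line M l i).
Proof.
split=> [MP l i | MP].
  have : ASM (n + n) (iter l (@turn _) M).
    by elim: (l : nat) => //= k; apply: ASM_turn.
  by move=> /ASM_linesP[rowP _]; apply: rowP.
have rowP : forall i, unit_line (M i).
  apply: rows_from_corners => i; first exact: (MP (Ordinal (isT : (0 < 4)%N))).
  exact: (MP (Ordinal (isT : (2 < 4)%N))).
have colP : forall i, unit_line (turn M i).
  apply: rows_from_corners => i; first exact: (MP (Ordinal (isT : (1 < 4)%N))).
  exact: (MP (Ordinal (isT : (3 < 4)%N))).
apply/ASM_linesP; split=> // j.
by apply: eq_unit_line (colP (rev_ord j)) => i; rewrite mxE rev_ordK.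
Qed.

(** The bound on the total sum is shown to be reached on this example. *)
Lemma ASM_identity N : ASM N 1%:M.
Proof.
have line1 (i : 'I_N) : unit_line (fun j : 'I_N => (i == j)%:R : int).
  split=> [k|]; last first.
    by rewrite (bigD1 i) //= eqxx big1 // => j /negPf ji; rewrite eq_sym ji.
  rewrite /psum; have [ik | ki] := ltnP i k.
    rewrite (bigD1 i) //= eqxx big1 // => j /andP[_ /negPf ji].
    by rewrite eq_sym ji.
  by rewrite big1 // => j jk; case: eqVneq => // ij; rewrite -ij ltnNge ki in jk.
apply/ASM_linesP; split=> i; apply: eq_unit_line (line1 i) => j; rewrite mxE //.
by rewrite eq_sym.
Qed.

(** * Maximality of the total sum *)

Lemma line_count n : \sum_(l < 4) \sum_(i < n) 1 = (n + n)%:R *+ 2 :> int.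
Proof. by rewrite !sumr_const !card_ord -!mulrnA; congr (_ *+ _); lia. Qed.

Lemma total_unit_lines n (M : 'M[int]_(n + n)) :
  (forall l i, unit_line (line M l i)) -> total_sum (corners M) = (n + n)%:R.
Proof.
move=> MP; apply: (pmulrnI (isT : (0 < 2)%N)); rewrite /= -total_corners.
under eq_bigr do under eq_bigr do rewrite (MP _ _).2.
exact: line_count.
Qed.

Lemma line_sum_le1 n (M : 'M[int]_(n + n)) l i :
  chained_circular (corners M) -> \sum_j line M l i j <= 1.
Proof.
move=> /chained_cornersP /(_ l i (n + n)%N); rewrite psum_all // => /bitE.
by case=> ->.
Qed.

Lemma total_chained_le n (M : 'M[int]_(n + n)) :
  chained_circular (corners M) -> total_sum (corners M) <= (n + n)%:R.
Proof.
move=> MP; rewrite -(ler_pMn2r (n := 2)) // -total_corners.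
by rewrite -line_count; apply: ler_sum => l _; apply: ler_sum => i _; apply: line_sum_le1.
Qed.

(** Each line falls short of 1 by a nonnegative amount, so no amount can be
    positive if they add up to at most 0. *)
Lemma total_chained_max n (M : 'M[int]_(n + n)) :
  chained_circular (corners M) -> (n + n)%:R <= total_sum (corners M) ->
  forall l i, \sum_j line M l i j = 1.
Proof.
move=> MP; rewrite -(ler_pMn2r (n := 2)) // -total_corners => big_sum l i.
have defect_ge0 l' i' : 0 <= 1 - \sum_j line M l' i' j.
  by rewrite subr_ge0 line_sum_le1.
have : \sum_l' \sum_i' (1 - \sum_j line M l' i' j) <= 0.
  under eq_bigr do rewrite sumrB.
  rewrite sumrB subr_le0; apply: le_trans big_sum.
  by rewrite line_count.
rewrite (bigD1 l) //= (bigD1 i) //= -addrA => sum_le0.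
apply/eqP; rewrite eq_le line_sum_le1 //= -subr_le0.
apply: le_trans sum_le0; rewrite lerDl addr_ge0 ?sumr_ge0 // => l' _.
exact: sumr_ge0.
Qed.

Lemma ASMcirc_cornersP n (M : 'M[int]_(n + n)) :
  ASMcirc n 4 (corners M) <-> ASM (n + n) M.
Proof.
split=> [[MP maxM] | /ASM_cornersP MP].
  have id_lines := (ASM_cornersP _).1 (ASM_identity (n + n)).
  apply/ASM_cornersP => l i; split; first by have /chained_cornersP := MP.
  apply: total_chained_max => //; rewrite -(total_unit_lines id_lines).
  by apply: maxM; apply/chained_cornersP => l' i'; case: (id_lines l' i').
split; first by apply/chained_cornersP => l i; case: (MP l i).
move=> B; rewrite (total_unit_lines MP) -[B]glueK; exact: total_chained_le.
Qed.

Theorem proposition4p11 (n : nat) (hn : (1 <= n)%N) :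
  exists f : 4.-tuple 'M[int]_n -> 'M[int]_(2 * n),
    set_bij (ASMcirc n 4) (ASM (2 * n)) f.
Proof.
rewrite mul2n -addnn; exists (@glue n); split.
- by move=> A AP; apply/ASMcirc_cornersP; rewrite glueK.
- by move=> A B _ _; apply: (can_inj (@glueK n)).
- by move=> M MP; exists (corners M); [apply/ASMcirc_cornersP | apply: cornersK].
Qed.
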